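(* Consider the DC/AC converter $$C_{dc}\dot v_{dc}=-G_{dc}v_{dc}+i_{dc}-\tfrac12m_{\alpha\beta}^\top i_{\alpha\beta},\qquad C\,\dot v_{\alpha\beta}=-i_{load}+i_{\alpha\beta},\qquad L\,\dot i_{\alpha\beta}=-R\,i_{\alpha\beta}+\tfrac12m_{\alpha\beta}v_{dc}-v_{\alpha\beta}.$$ For any modulation signal $m_{\alpha\beta}$, the system is passive with respect to the input $u=\begin{bmatrix}i_{dc}&-i_{load}^\top\end{bmatrix}^\top$ and the output $y=\begin{bmatrix}v_{dc}&v_{\alpha\beta}^\top\end{bmatrix}^\top$.
   Context: $v_{dc}(t)\in\mathbb R$ and $v_{\alpha\beta}(t),i_{\alpha\beta}(t)\in\mathbb R^2$ are the states; $m_{\alpha\beta}(t)\in\mathbb R^2$ is the modulation signal; $i_{dc}(t)\in\mathbb R$ and $i_{load}(t)\in\mathbb R^2$ are inputs; $C_{dc},G_{dc},C,L,R>0$ are constants. A system with state $x$, input $u$ and output $y$ is passive if there is a continuously differentiable storage function $S(x)\ge0$ with $\dot S\le u^\top y$ along all trajectories. *)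

(* Defs.v *)
From HB Require Import structures.
From mathcomp Require Import all_boot all_order all_algebra.
From mathcomp Require Import all_classical all_reals all_analysis.

Set Implicit Arguments.
Unset Strict Implicit.
Unset Printing Implicit Defensive.

Import Order.TTheory GRing.Theory Num.Theory.
Import numFieldNormedType.Exports.

Local Open Scope ring_scope.
Local Open Scope classical_set_scope.

Definition dot (R : realType) (n : nat) (u v : 'cV[R]_n) : R := (u^T *m v) 0 0.

(* In finite dimension, continuity of the differential [x |-> 'd S x] amounts
   to continuity of each directional derivative. *)
Definition continuously_differentiable (R : realType) (n : nat)
    (S : 'cV[R]_n -> R) : Prop :=
  (forall x, differentiable S x) /\
  (forall v : 'cV[R]_n, continuous (fun x => 'D_v S x)).

(* A system with state in R^n and input and output in R^p is given by its
   trajectories: [traj J x u y] says that the signals x, u, y form a trajectory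
   over the time interval J. *)
Definition system (R : realType) (n p : nat) :=
  set R -> (R -> 'cV[R]_n) -> (R -> 'cV[R]_p) -> (R -> 'cV[R]_p) -> Prop.

(* [derivable] is required explicitly: [derive1] is total, and its
   value is meaningful only for a derivable function. *)
Definition passive (R : realType) (n p : nat) (traj : system R n p) : Prop :=
  exists S : 'cV[R]_n -> R,
    [/\ continuously_differentiable S,
        forall x, 0 <= S x &
        forall J x u y, traj J x u y -> forall t, J t ->
          derivable (S \o x) t 1 /\ derive1 (S \o x) t <= dot (u t) (y t)].

(* Trajectories are classical solutions over an arbitrary open interval J. The
   signals are total functions of time, but only their values on J matter; in
   particular J may be any interval between two discontinuities of m or of the
   inputs. The parameter Res is the resistance. *)
Definition converter (R : realType) (Cdc Gdc C L Res : R) (m : R -> 'cV[R]_2) :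
    system R (1 + (2 + 2)) (1 + 2) :=
  fun J x u y =>
    open J /\ is_interval J /\
    exists (vdc : R -> R) (v i : R -> 'cV[R]_2)
           (idc : R -> R) (iload : R -> 'cV[R]_2),
      [/\ x = (fun t => col_mx (vdc t)%:M (col_mx (v t) (i t))),
          u = (fun t => col_mx (idc t)%:M (- iload t)),
          y = (fun t => col_mx (vdc t)%:M (v t)) &
          forall t, J t ->
            [/\ derivable vdc t 1, derivable v t 1 & derivable i t 1] /\
            [/\ Cdc * derive1 vdc t
                  = - Gdc * vdc t + idc t - 2^-1 * dot (m t) (i t),
                C *: derive1 v t = - iload t + i t &
                L *: derive1 i t
                  = - Res *: i t + 2^-1 *: (vdc t *: m t) - v t]].

(* Main.v *)
Require Import Defs.
From HB Require Import structures.
From mathcomp Require Import all_boot all_order all_algebra.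
From mathcomp Require Import all_classical all_reals all_analysis.
From mathcomp Require Import ring.

Import Order.TTheory GRing.Theory Num.Theory.
Import numFieldNormedType.Exports.

Local Open Scope ring_scope.

(** The storage function is the energy held by the capacitors and the inductors,
      S = (Cdc vdc^2 + C |v|^2 + L |i|^2) / 2.
    Along a trajectory its derivative is the sum of each state variable times
    its own equation of motion.  In that sum the modulation terms cancel: the
    power (vdc m^T i) / 2 that leaves the DC capacitor is the power that enters
    the inductors, whatever m is.  The power v^T i exchanged between the
    inductors and the AC capacitors cancels likewise.  What remains is the
    supplied power u^T y minus the resistive losses Gdc vdc^2 + Res |i|^2
    ([power_balance]), and the losses are nonnegative.

    S is a diagonal quadratic form, so a single chain rule
    ([is_derive_weighted_energy]) gives both its directional derivatives, which
    are linear in the state and therefore continuous, and its time derivative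
    along a trajectory. *)

Definition weighted_energy {R : realType} {n : nat} (w x : 'cV[R]_n) : R :=
  2^-1 * \sum_k w k 0 * x k 0 ^+ 2.

Lemma weighted_energy_ge0 (R : realType) (n : nat) (w x : 'cV[R]_n) :
  (forall k, 0 <= w k 0) -> 0 <= weighted_energy w x.
Proof.
move=> w_ge0; rewrite mulr_ge0 ?invr_ge0 ?ler0n// sumr_ge0// => k _.
by rewrite mulr_ge0 ?sqr_ge0.
Qed.

(** The differentiation rules for sums, scalings and powers are about
    operations on functions, hence this point-free form. *)
Lemma weighted_energy_comp (R : realType) (T : Type) (n : nat) (w : 'cV[R]_n)
    (z : T -> 'cV[R]_n) :
  weighted_energy w \o z =
    2^-1 *: \sum_k (w k 0 *: (fun s => z s k 0) ^+ 2).
Proof. by apply/funext => s; rewrite fctE fct_sumE. Qed.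

(** The domain V is kept arbitrary in order to cover two cases: V the time axis
    and z a trajectory, and V the state space and z the identity. *)
Lemma is_derive_weighted_energy (R : realType) (V : normedModType R) (n : nat)
    (w : 'cV[R]_n) (z : V -> 'cV[R]_n) (a h : V) (dz : 'I_n -> R) :
  (forall k, is_derive a h (fun s => z s k 0) (dz k)) ->
  is_derive a h (weighted_energy w \o z) (\sum_k w k 0 * z a k 0 * dz k).
Proof.
move=> dzE; rewrite weighted_energy_comp.
have dterm k : is_derive a h (w k 0 *: (fun s => z s k 0) ^+ 2)
                         (w k 0 *: ((2%:R * z a k 0 ^+ 1) *: dz k)).
  exact: is_deriveZ (is_deriveX _ (dzE k)).
apply: (is_derive_eq (is_deriveZ _ (is_derive_sum dterm))).
rewrite scaler_sumr; apply: eq_bigr => k _.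
by rewrite /GRing.scale/= expr1; field.
Qed.

Lemma is_derive_coord (R : realType) (n : nat) (x v : 'cV[R]_n) (k : 'I_n) :
  is_derive x v (fun y : 'cV[R]_n => y k 0) (v k 0).
Proof.
apply: DeriveDef; first by apply: diff_derivable; exact: differentiable_coord.
have := derive_mx (@derivable_id _ _ x v).
by rewrite derive_id => /matrixP/(_ k 0); rewrite mxE => <-.
Qed.

Lemma weighted_energy_C1 (R : realType) (n : nat) (w : 'cV[R]_n) :
  continuously_differentiable (weighted_energy w).
Proof.
split=> [x|v].
  rewrite (weighted_energy_comp _ _ _ w id : weighted_energy w = _).
  apply: differentiableZ; apply: differentiable_sum => k.
  by apply: differentiableZ; apply: differentiableX; exact: differentiable_coord.
have -> : (fun x => 'D_v (weighted_energy w) x) =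
          fun x => \sum_k w k 0 * x k 0 * v k 0.
  apply/funext => x.
  by have [] := is_derive_weighted_energy _ _ _ w id _ _ _
                  (is_derive_coord _ _ x v).
apply: continuous_big => [|k _ x]; first exact: add_continuous.
exact: cvgM (cvgM (cvg_cst _) (@coord_continuous _ _ _ k 0 x)) (cvg_cst _).
Qed.

Lemma is_derive_entry (R : realType) (n p : nat) (z : R -> 'M[R]_(n, p))
    (t : R) (i : 'I_n) (j : 'I_p) : derivable z t 1 ->
  is_derive t 1 (fun s => z s i j) (derive1 z t i j).
Proof.
move=> dz; rewrite derive1E derive_mx// mxE; apply: derivableP.
by move/derivable_mxP : dz; apply.
Qed.

Lemma dotE (R : realType) (n : nat) (u v : 'cV[R]_n) :
  dot u v = \sum_k u k 0 * v k 0.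
Proof. by rewrite /dot mxE; apply: eq_bigr => k _; rewrite mxE. Qed.

(** Conservation of power at one instant: rate of change of the stored energy =
    supplied power - losses.  The symbols dvdc, dv and di stand for the time
    derivatives; only the algebra of the three balance laws matters, and m
    drops out of the result. *)
Lemma power_balance (R : realType) (n : nat) (Cdc Gdc C L Res : R)
    (vdc dvdc idc : R) (v dv i di iload m : 'cV[R]_n) :
  Cdc * dvdc = - Gdc * vdc + idc - 2^-1 * dot m i ->
  C *: dv = - iload + i ->
  L *: di = - Res *: i + 2^-1 *: (vdc *: m) - v ->
  Cdc * vdc * dvdc
    + (\sum_k C * v k 0 * dv k 0 + \sum_k L * i k 0 * di k 0)
  = idc * vdc + dot (- iload) v - (Gdc * vdc ^+ 2 + Res * dot i i).
Proof.
move=> Edc /matrixP Ev /matrixP Ei.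
have -> : Cdc * vdc * dvdc = vdc * (Cdc * dvdc) by ring.
have -> : \sum_k C * v k 0 * dv k 0 + \sum_k L * i k 0 * di k 0 =
          dot (- iload) v + 2^-1 * vdc * dot m i - Res * dot i i.
  rewrite !dotE !mulr_sumr -!big_split -sumrB /=; apply: eq_bigr => k _.
  have := Ev k 0; have := Ei k 0; rewrite !mxE => Eik Evk.
  have -> : C * v k 0 * dv k 0 = v k 0 * (C * dv k 0) by ring.
  have -> : L * i k 0 * di k 0 = i k 0 * (L * di k 0) by ring.
  by rewrite Evk Eik; ring.
by rewrite Edc; ring.
Qed.

Theorem lemma5p4p1 (R : realType) (Cdc Gdc C L Res : R)
    (Cdc_gt0 : 0 < Cdc) (Gdc_gt0 : 0 < Gdc) (C_gt0 : 0 < C) (L_gt0 : 0 < L)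
    (Res_gt0 : 0 < Res) (m : R -> 'cV[R]_2) :
  passive (converter Cdc Gdc C L Res m).
Proof.
pose w : 'cV[R]_(1 + (2 + 2)) :=
  col_mx Cdc%:M (col_mx (const_mx C) (const_mx L)).
exists (weighted_energy w); split; first exact: weighted_energy_C1.
  move=> x; apply: weighted_energy_ge0 => k; rewrite /w.
  case: (split_ordP k) => [a ->|b ->]; rewrite ?col_mxEu ?col_mxEd.
    by rewrite (ord1 a) mxE eqxx mulr1n ltW.
  by case: (split_ordP b) => c ->; rewrite ?col_mxEu ?col_mxEd mxE ltW.
move=> J x u y [_ [_ [vdc [v [i [idc [iload [-> -> -> dyn]]]]]]]] t Jt.
have [[dvdc dv di] [Evdc Ev Ei]] := dyn t Jt.
pose dx : 'cV[R]_(1 + (2 + 2)) :=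
  col_mx (derive1 vdc t)%:M (col_mx (derive1 v t) (derive1 i t)).
have dxE k : is_derive t 1
    (fun s => col_mx (vdc s)%:M (col_mx (v s) (i s)) k 0) (dx k 0).
  rewrite /dx; case: (split_ordP k) => [a ->|b ->].
    under eq_fun do rewrite col_mxEu (ord1 a) mxE eqxx mulr1n.
    rewrite col_mxEu (ord1 a) mxE eqxx mulr1n derive1E; exact: derivableP.
  under eq_fun do rewrite col_mxEd.
  rewrite col_mxEd; case: (split_ordP b) => c ->.
    under eq_fun do rewrite col_mxEu.
    by rewrite col_mxEu; exact: is_derive_entry.
  under eq_fun do rewrite col_mxEd.
  by rewrite col_mxEd; exact: is_derive_entry.
have [derS dS] := is_derive_weighted_energy _ _ _ w _ _ _ _ dxE.
split=> //; rewrite derive1E dS.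
have -> : \sum_k w k 0 * col_mx (vdc t)%:M (col_mx (v t) (i t)) k 0 * dx k 0 =
    Cdc * vdc t * derive1 vdc t
    + (\sum_k C * v t k 0 * derive1 v t k 0
       + \sum_k L * i t k 0 * derive1 i t k 0).
  rewrite !big_split_ord /= big_ord1 /w /dx; congr (_ + (_ + _)).
  - by rewrite !col_mxEu !mxE !mulr1n.
  - by apply: eq_bigr => k _; rewrite !col_mxEd !col_mxEu mxE.
  - by apply: eq_bigr => k _; rewrite !col_mxEd mxE.
have -> : dot (col_mx (idc t)%:M (- iload t)) (col_mx (vdc t)%:M (v t)) =
    idc t * vdc t + dot (- iload t) (v t).
  rewrite !dotE big_split_ord /= big_ord1; congr (_ + _).
    by rewrite !col_mxEu !mxE !mulr1n.
  by apply: eq_bigr => k _; rewrite !col_mxEd.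
rewrite (power_balance _ _ _ _ _ _ _ _ _ _ _ _ _ _ _ _ Evdc Ev Ei).
rewrite gerBl; apply: addr_ge0; apply: mulr_ge0; rewrite ?sqr_ge0//.
- exact: ltW.
- exact: ltW.
by rewrite dotE sumr_ge0// => k _; rewrite -expr2 sqr_ge0.
Qed.
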